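(* Let $r\ge1$ be an integer. The operator $\widetilde{T}_{n,r}$ is uniformly bounded on $C^{r}[c,d]$. More precisely, there exists a constant $C_r>0$, depending only on $r$, the activation function $\sigma$, and the mesh parameters $d_1,d_2$, such that $$\|\widetilde{T}_{n,r}(g)\|_\infty\le C_r\,\|g\|_{C^{r}}\qquad\text{for all } g\in C^{r}[c,d].$$
   Context: Setting. $[c,d]\subset\mathbb{R}$ is a compact interval, functions are real-valued, $\|g\|_\infty=\sup_{y\in[c,d]}|g(y)|$, $C^{r}[c,d]$ is the space of functions whose derivatives up to order $r$ exist and are continuous on $[c,d]$, with norm $\|g\|_{C^r}:=\sum_{j=0}^{r}\|g^{(j)}\|_\infty$. Irregular grid. $c=z_0<z_1<\cdots<z_n=d$ is a partition with $0<d_1\le z_{k+1}-z_k\le d_2$ for $k=0,\dots,n-1$, where $d_2<2d_1$; here $d_1=\min_k(z_{k+1}-z_k)$ is the minimum mesh size. Activation. For $m>0$, $D(m)$ is the class of measurable functions $\eta:\mathbb{R}\to\mathbb{R}$ that are increasing (i.e. non-decreasing), with $\eta(y)=0$ for $y\le -m$, $\eta(y)=1$ for $y\ge m$, and $0<\eta(y)<1$ for $-m<y<m$. Fix $\eta\in D(m)$ and put $\sigma(y):=\eta(y+m)-\eta(y-m)$, $y\in\mathbb{R}$. Operator. For $g\in C^r[c,d]$ let $P_r(g;y,z_k):=\sum_{j=0}^{r}\frac{g^{(j)}(z_k)}{j!}(y-z_k)^j$ and $$\widetilde{T}_{n,r}(g,y):=\frac{\sum_{k=0}^{n}\sigma\!\left(\frac{2m}{d_1}(y-z_k)\right)P_r(g;y,z_k)}{\sum_{k=0}^{n}\sigma\!\left(\frac{2m}{d_1}(y-z_k)\right)},\qquad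 y\in[c,d].$$ $\widetilde{T}_{n,r}(g)$ denotes the function $y\mapsto\widetilde{T}_{n,r}(g,y)$. *)

(* Defs.v *)
From HB Require Import structures.
From mathcomp Require Import all_boot all_order all_algebra.
From mathcomp Require Import all_classical all_reals all_analysis.

Set Implicit Arguments.
Unset Strict Implicit.
Unset Printing Implicit Defensive.

Import Order.TTheory GRing.Theory Num.Theory.
Import numFieldNormedType.Exports.

Local Open Scope classical_set_scope.
Local Open Scope ring_scope.

(* A function on [c, d] is a total function R -> R of which only the values on
   [c, d] matter: the difference quotient below is taken along y in [c, d],
   so that the derivatives at c and d are one-sided. *)
Definition diff_quot (R : realType) (f : R -> R) (x y : R) : R :=
  (f y - f x) / (y - x).

Definition derivable_on (R : realType) (c d : R) (f : R -> R) (x : R) : Prop :=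
  cvg (diff_quot f x y @[y --> within `[c, d] x^']).

Definition derive_on (R : realType) (c d : R) (f : R -> R) : R -> R :=
  fun x => lim (diff_quot f x y @[y --> within `[c, d] x^']).

Definition deriven_on (R : realType) (c d : R) (j : nat) (f : R -> R) : R -> R :=
  iter j (derive_on c d) f.

Definition is_Cr (R : realType) (c d : R) (r : nat) (g : R -> R) : Prop :=
  (forall j, (j < r)%N ->
     forall x, x \in `[c, d] -> derivable_on c d (deriven_on c d j g) x) /\
  (forall j, (j <= r)%N -> {within `[c, d], continuous (deriven_on c d j g)}).

(* The norms are extended-real valued: the real-valued [sup] of an unbounded
   set is 0, which would make a bound on it meaningless. *)
Definition sup_norm (R : realType) (c d : R) (f : R -> R) : \bar R :=
  ereal_sup [set (`|f y|)%:E | y in `[c, d]].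

Definition Cr_norm (R : realType) (c d : R) (r : nat) (g : R -> R) : \bar R :=
  (\sum_(j < r.+1) sup_norm c d (deriven_on c d j g))%E.

Definition classD (R : realType) (m : R) (eta : R -> R) : Prop :=
  [/\ measurable_fun setT eta,
      {homo eta : x y / x <= y},
      forall y, y <= - m -> eta y = 0,
      forall y, m <= y -> eta y = 1
    & forall y, - m < y -> y < m -> 0 < eta y < 1].

Definition sigma_of (R : realType) (m : R) (eta : R -> R) : R -> R :=
  fun y => eta (y + m) - eta (y - m).

(* Only z 0, ..., z n are relevant. The last clause says that the lower bound
   d1 is attained, i.e. that d1 is the minimum mesh size. *)
Definition irregular_grid (R : realType) (c d d1 d2 : R) (n : nat) (z : nat -> R)
    : Prop :=
  [/\ z 0%N = c,
      z n = d,
      forall k, (k < n)%N -> z k < z k.+1,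
      forall k, (k < n)%N -> d1 <= z k.+1 - z k <= d2
    & exists2 k, (k < n)%N & z k.+1 - z k = d1].

Definition taylor_on (R : realType) (c d : R) (r : nat) (g : R -> R) (y a : R) : R :=
  \sum_(j < r.+1) deriven_on c d j g a / (j`!)%:R * (y - a) ^+ j.

Definition T_op (R : realType) (m : R) (sigma : R -> R) (c d d1 : R) (n : nat)
    (z : nat -> R) (r : nat) (g : R -> R) (y : R) : R :=
  (\sum_(k < n.+1) sigma (2 * m / d1 * (y - z k)) * taylor_on c d r g y (z k))
  / (\sum_(k < n.+1) sigma (2 * m / d1 * (y - z k))).

(* Main.v *)
Require Import Defs.
From mathcomp Require Import all_boot all_order all_algebra.
From mathcomp Require Import all_classical all_reals all_analysis.
From mathcomp Require Import lra.

(** The operator is a weighted mean of Taylor polynomials with nonnegative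
    weights, and the weight at [z k] vanishes as soon as [d1 <= |y - z k|].
    Every Taylor polynomial that contributes is therefore evaluated within
    distance [d1] of its base point, where it is at most
    [(1 + d1) ^+ r * \sum_j |g^(j) (z k)|]. *)

Import Order.TTheory GRing.Theory Num.Theory.

Local Open Scope ring_scope.

(* When all the weights vanish, the quotient is [x / 0 = 0]. *)
Lemma norm_weighted_mean_le (R : realFieldType) (I : finType) (w p : I -> R)
    (M : R) :
  0 <= M -> (forall i, 0 <= w i) -> (forall i, w i != 0 -> `|p i| <= M) ->
  `|(\sum_i w i * p i) / (\sum_i w i)| <= M.
Proof.
move=> M0 w0 pM.
have [->|W0] := eqVneq (\sum_i w i) 0; first by rewrite invr0 mulr0 normr0.
have W_gt0 : 0 < \sum_i w i by rewrite lt0r W0 sumr_ge0.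
rewrite normrM normfV (gtr0_norm W_gt0) ler_pdivrMr // mulr_sumr.
apply: le_trans (ler_norm_sum _ _ _) _; apply: ler_sum => i _.
rewrite normrM (ger0_norm (w0 i)) mulrC.
(* The bound on [p i] is available only where [w i] is nonzero; elsewhere both sides vanish. *)
have [->|wi0] := eqVneq (w i) 0; first by rewrite !mulr0.
by rewrite ler_wpM2r // pM.
Qed.

Lemma sigma_of_ge0 (R : realType) (m : R) (eta : R -> R) (x : R) :
  0 < m -> classD m eta -> 0 <= sigma_of m eta x.
Proof. by move=> m0 [_ eta_homo _ _ _]; rewrite subr_ge0 eta_homo //; lra. Qed.

(** Both [x + m] and [x - m] then lie in the same half-line, above [m] or below [- m], where [eta]
    is constant. *)
Lemma sigma_of_eq0 (R : realType) (m : R) (eta : R -> R) (x : R) :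
  0 < m -> classD m eta -> 2 * m <= `|x| -> sigma_of m eta x = 0.
Proof.
move=> m0 [_ _ eta0 eta1 _]; rewrite ler_normr /sigma_of => /orP[mx|mx].
  by rewrite !eta1 ?subrr //; lra.
by rewrite !eta0 ?subrr //; lra.
Qed.

(** The factor [2 * m / d1] turns the support radius [2 * m] of [sigma_of m eta] into [d1]. *)
Lemma sigma_of_neq0_dist (R : realType) (m : R) (eta : R -> R) (d1 y a : R) :
  0 < m -> classD m eta -> 0 < d1 ->
  sigma_of m eta (2 * m / d1 * (y - a)) != 0 -> `|y - a| < d1.
Proof.
move=> m0 etaD d0; apply: contra_neqT; rewrite -leNgt => d1_le.
have md_gt0 : 0 < 2 * m / d1 by rewrite divr_gt0 // mulr_gt0.
apply: sigma_of_eq0 => //; rewrite normrM (gtr0_norm md_gt0).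
by rewrite mulrAC ler_pdivlMr // ler_pM2l // mulr_gt0.
Qed.

Lemma grid_mem (R : realType) (c d d1 d2 : R) (n : nat) (z : nat -> R) (k : nat) :
  irregular_grid c d d1 d2 n z -> (k <= n)%N -> z k \in `[c, d].
Proof.
move=> [z0 zn z_lt _ _] kn.
(* Monotonicity is claimed only up to index [n], since later values of [z] are arbitrary. *)
have z_le i j : (i <= j)%N -> (j <= n)%N -> z i <= z j.
  elim: j => [|j IH]; first by rewrite leqn0 => /eqP->.
  rewrite leq_eqVlt => /predU1P[-> //|ij jn].
  by rewrite (le_trans (IH ij (ltnW jn))) // ltW // z_lt.
by rewrite in_itv /= -z0 -zn !z_le.
Qed.

Lemma norm_taylor_on_le (R : realType) (c d : R) (r : nat) (g : R -> R)
    (y a e : R) :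
  `|y - a| <= e ->
  `|taylor_on c d r g y a|
    <= (1 + e) ^+ r * \sum_(j < r.+1) `|deriven_on c d j g a|.
Proof.
move=> ya; have e0 : 0 <= e := le_trans (normr_ge0 _) ya.
apply: le_trans (ler_norm_sum _ _ _) _; rewrite mulr_sumr.
apply: ler_sum => j _; rewrite normrM [leRHS]mulrC ler_pM //.
  by rewrite normrM ler_piMr // normfV normr_nat invf_le1 ?ler1n ?ltr0n ?fact_gt0.
(* The base [1 + e] is at least 1, unlike [e], so its powers grow with the exponent and the [r]-th
   one serves every [j]. *)
rewrite normrX (@le_trans _ _ ((1 + e) ^+ j)) //.
  by apply: lerXn2r; rewrite ?nnegrE ?normr_ge0 //; lra.
by apply: ler_weXn2l; [lra | rewrite -ltnS].
Qed.

Lemma sum_norm_deriven_le_Cr_norm (R : realType) (c d : R) (r : nat)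
    (g : R -> R) (a : R) :
  a \in `[c, d] ->
  ((\sum_(j < r.+1) `|deriven_on c d j g a|)%:E <= Cr_norm c d r g)%E.
Proof.
move=> acd; rewrite -sumEFin; apply: lee_sum => j _.
by apply: ereal_sup_ubound; exists a.
Qed.

Theorem theorem2p3 (R : realType) (r : nat) (hr : (1 <= r)%N)
  (m : R) (hm : 0 < m) (eta : R -> R) (heta : classD m eta)
  (d1 d2 : R) (hd1 : 0 < d1) (hd2 : d2 < 2 * d1) :
  exists2 C : R, 0 < C &
    forall (c d : R) (n : nat) (z : nat -> R),
      c < d ->
      irregular_grid c d d1 d2 n z ->
      forall g : R -> R, is_Cr c d r g ->
        (sup_norm c d (T_op m (sigma_of m eta) c d d1 n z r g)
           <= C%:E * Cr_norm c d r g)%E.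
Proof.
have C_gt0 : 0 < (1 + d1) ^+ r by rewrite exprn_gt0 //; lra.
(* This is the Taylor factor for [e := d1], the radius within which a weight can be nonzero; it is
   fixed before the interval and the grid. *)
exists ((1 + d1) ^+ r) => // c d n z _ grid g _.
apply: ge_ereal_sup => _ [y _ <-].
have sum_le (k : 'I_n.+1) := sum_norm_deriven_le_Cr_norm _ _ _ r g _
  (grid_mem _ _ _ _ _ _ _ _ grid (ltn_ord k)).
(* The node [z 0] bounds the norm below by a nonnegative real: this excludes [-oo] and later gives
   [0 <= N]. If the norm is [+oo], so is the right-hand side, as the constant is positive. *)
have := sum_le ord0.
case: (Cr_norm c d r g) sum_le => [N| |] sum_le //=; last first.
  by move=> _; rewrite gt0_muley ?lte_fin // leey.
rewrite lee_fin => N_ge.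
have N0 : 0 <= N by apply: le_trans N_ge; rewrite sumr_ge0.
rewrite -EFinM lee_fin; apply: norm_weighted_mean_le => [|k|k wk].
- by rewrite mulr_ge0 // ltW.
- exact: sigma_of_ge0.
- apply: le_trans (norm_taylor_on_le _ c d r g y (z k) d1 _) _.
    exact/ltW/(sigma_of_neq0_dist _ m eta).
  by rewrite ler_pM2l // -lee_fin sum_le.
Qed.
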